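(* Let $K$ be an infinite field of characteristic different from $2$ and $3$, and let $(A,\omega)$ be a Bernstein algebra over $K$. If $A$ is algebraic of degree $\le 2$, then $A$ is a Jordan algebra.
   Context: Algebras are not assumed associative, unital or finite-dimensional. A Bernstein algebra over $K$ is a commutative $K$-algebra $A$ with a nonzero algebra homomorphism $\omega:A\to K$ satisfying $(x^2)^2=\omega(x)^2x^2$ for all $x$. $A$ is algebraic of degree $\le 2$ if for every $a\in A$ the subalgebra generated by $a$ has dimension at most $2$. A commutative algebra is a Jordan algebra if $x(x^2y)=x^2(xy)$ for all $x,y$. *)

(* Defs.v *)
From HB Require Import structures.
From mathcomp Require Import all_boot all_algebra sesquilinear.
From mathcomp Require Import classical_sets cardinality.

Set Implicit Arguments.
Unset Strict Implicit.
Unset Printing Implicit Defensive.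

Import GRing.Theory.
Local Open Scope classical_set_scope.
Local Open Scope ring_scope.

(* A K-algebra, not assumed associative, unital or finite-dimensional, is a
   K-vector space A together with a bilinear map mul : A -> A -> A. *)

Section Algebras.
Variables (K : fieldType) (A : lmodType K).
Implicit Types (S : set A) (mul : {bilinear A -> A -> A}).

Definition linear_comb n (e : 'I_n -> A) (c : 'I_n -> K) : A :=
  \sum_i c i *: e i.

Definition lin_indep n (e : 'I_n -> A) : Prop :=
  forall c : 'I_n -> K, linear_comb e c = 0 -> forall i, c i = 0.

Definition is_basis S n (e : 'I_n -> A) : Prop :=
  lin_indep e /\ S = range (linear_comb e).

Definition dim_le S (d : nat) : Prop :=
  exists2 n, (n <= d)%N & exists e : 'I_n -> A, is_basis S e.

(* Subalgebras are not required to contain a unit. *)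
Definition is_subalgebra mul S : Prop :=
  [/\ S 0,
      forall x y, S x -> S y -> S (x + y),
      forall (k : K) x, S x -> S (k *: x)
    & forall x y, S x -> S y -> S (mul x y)].

Definition subalgebra_gen mul (a : A) : set A :=
  smallest (is_subalgebra mul) [set a].

Definition algebraic_of_degree_le mul (d : nat) : Prop :=
  forall a : A, dim_le (subalgebra_gen mul a) d.

Definition is_bernstein mul (omega : {scalar A}) : Prop :=
  [/\ commutative mul,
      exists x, omega x != 0,
      forall x y, omega (mul x y) = omega x * omega y
    & forall x, mul (mul x x) (mul x x) = omega x ^+ 2 *: mul x x].

Definition is_jordan mul : Prop :=
  commutative mul /\
  forall x y, mul x (mul (mul x x) y) = mul (mul x x) (mul x y).

End Algebras.

(* Main.v *)
(* For x of weight 1, e = x^2 is idempotent; put n = x - e.  Polarizing the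
   Bernstein identity at e gives 2 e(en) = en.  A linear relation between x, x^2
   and x^3 makes n an eigenvector of multiplication by e unless en = 0, and the
   eigenvalue 1/2 would give n^2 = -n, contradicting (n^2)^2 = 0.  Hence en = 0,
   i.e. x^3 = x^2, and by homogeneity and polarization x^3 = omega(x) x^2 for
   all x.  With T x s = xs - omega(x) s this reads T x (x^2) = 0 and polarizes to
   2 T x (xz) + T z (x^2) = 0; the Jordan identity is the difference between
   this relation at z = xy and x times this relation at z = y. *)
Require Import Defs.
From mathcomp Require Import all_boot all_algebra sesquilinear.
From mathcomp Require Import classical_sets cardinality.
From mathcomp Require Import ring.
Import GRing.Theory.
Set Implicit Arguments.
Unset Strict Implicit.
Unset Printing Implicit Defensive.

Local Open Scope classical_set_scope.
Local Open Scope ring_scope.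

(** The coordinates of the [v i] form a matrix with more rows than columns, so its left kernel
    contains a nonzero row, which is a nontrivial relation. *)
Lemma dim_le_dependent (K : fieldType) (A : lmodType K) (S : set A) d m
    (v : 'I_m -> A) :
  dim_le S d -> (d < m)%N -> (forall i, S (v i)) -> ~ lin_indep v.
Proof.
move=> [n le_nd [e [_ ->]]] lt_dm Sv indep.
have /boolp.choice[c vE] i : exists c, linear_comb e c = v i.
  by case: (Sv i) => c _ <-; exists c.
pose C := \matrix_(i < m, j < n) c i j.
have : kermx C != 0.
  rewrite kermx_eq0 /row_free neq_ltn (leq_ltn_trans (rank_leq_col _)) //.
  exact: leq_ltn_trans lt_dm.
case/rowV0Pn => r /sub_kermxP rC; apply/negP; rewrite negbK.
apply/eqP/rowP => i; rewrite mxE; apply: (indep (r 0)).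
rewrite /linear_comb.
transitivity (\sum_i \sum_j (r 0 i * C i j) *: e j).
  apply: eq_bigr => k _; rewrite -vE /linear_comb scaler_sumr.
  by apply: eq_bigr => j _; rewrite mxE scalerA.
rewrite exchange_big big1 // => j _; rewrite -scaler_suml.
by have /rowP/(_ j) := rC; rewrite !mxE => ->; rewrite scale0r.
Qed.

Lemma subalgebra_gen_id (K : fieldType) (A : lmodType K)
    (mul : {bilinear A -> A -> A}) a : subalgebra_gen mul a a.
Proof. by move=> S [_]; apply. Qed.

Lemma subalgebra_genM (K : fieldType) (A : lmodType K)
    (mul : {bilinear A -> A -> A}) a x y :
  subalgebra_gen mul a x -> subalgebra_gen mul a y ->
  subalgebra_gen mul a (mul x y).
Proof.
move=> Sx Sy S HS; have [[_ _ _ SM] _] := HS.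
by apply: SM; [apply: Sx | apply: Sy].
Qed.

Section BernsteinDegreeTwo.
Variables (K : fieldType) (A : lmodType K).
Hypotheses (K2 : (2 : K) != 0) (K3 : (3 : K) != 0).

Lemma addrr_eq0 (a : A) : a + a = 0 -> a = 0.
Proof.
by move/eqP; rewrite -mulr2n -scaler_nat scaler_eq0 (negPf K2) => /eqP.
Qed.

(** The values at 1, -1 and 2 suffice: the first two give [2b = 0], and then those at 1 and 2 give
    [3c = 0]. The point [t = 0] is left out because the uses divide by [t] or need a nonzero
    weight. *)
Lemma quadratic_coef_eq0 (a b c : A) :
  (forall t : K, t != 0 -> a + t *: (b + t *: c) = 0) ->
  [/\ a = 0, b = 0 & c = 0].
Proof.
move=> abc0; have := abc0 1 (oner_neq0 K).
have := abc0 (-1); rewrite oppr_eq0 oner_neq0 => /(_ isT).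
rewrite !scale1r !scaleN1r opprB => abcN1 abc1.
have b0 : b = 0.
  apply: addrr_eq0; rewrite -(subrr 0) -{1}abc1 -abcN1 opprD opprB.
  by rewrite addrACA subrr add0r addrCA addrK.
move: abc1 (abc0 2 K2); rewrite b0 !add0r scalerA => ac1 ac2.
have c0 : c = 0.
  apply/eqP; have: (3 : K) *: c == 0.
    have -> : (3 : K) = 2 * 2 - 1 by ring.
    rewrite scalerBl scale1r -(subrr 0) -{1}ac2 -ac1 opprD.
    by rewrite addrACA subrr add0r.
  by rewrite scaler_eq0 (negPf K3).
by split=> //; rewrite -ac1 c0 addr0.
Qed.

Variables (mul : {bilinear A -> A -> A}) (omega : {scalar A}).
Hypothesis bern : is_bernstein mul omega.

Let mulC : commutative mul. Proof. by case: bern. Qed.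
Let omegaM x y : omega (mul x y) = omega x * omega y. Proof. by case: bern. Qed.
Let omegaDZ x t y : omega (x + t *: y) = omega x + t * omega y.
Proof. by rewrite linearD linearZ. Qed.

Lemma sqrDZ a t b : mul (a + t *: b) (a + t *: b) =
  mul a a + t *: (mul a b + mul a b + t *: mul b b).
Proof.
rewrite linearDl !linearDr !(linearZl_LR, linearZr_LR) /= (mulC b a).
by rewrite !scalerDr !addrA.
Qed.

Lemma idempotent_peirce e n : mul e e = e -> omega e = 1 -> omega n = 0 ->
  mul e (mul e n) + mul e (mul e n) = mul e n.
Proof.
move=> ee we wn; case: bern => _ _ _ B.
(* This is the top coefficient in [t] of the identity at [e + t n]; without it, removing [e] and
   dividing by [t] leaves a quadratic, whose constant term is [4 e(en) - 2 en]. *)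
have nn0 : mul (mul n n) (mul n n) = 0 by rewrite B wn expr0n scale0r.
set p := mul e n; set q := mul n n; set ep := mul e p.
have [] := @quadratic_coef_eq0 (ep + ep + (ep + ep) - (p + p))
  (mul e q + mul e q - q + mul (p + p) (p + p))
  (mul (p + p) q + mul (p + p) q); last first.
  by rewrite opprD addrACA => /addrr_eq0/eqP; rewrite subr_eq0 => /eqP.
move=> t t0.
have := B (e + t *: n).
rewrite omegaDZ wn mulr0 addr0 we expr1n scale1r !sqrDZ ee.
rewrite -/p -/q nn0 scaler0 addr0 ee.
move/addrI/(scalerI t0)/eqP; rewrite -subr_eq0 => /eqP h.
rewrite -[RHS]h.
set r := mul (p + p) (p + p); set r' := mul (p + p) q.
rewrite !linearDr linearZr_LR -/ep /= (addrACA (ep + ep) (t *: _)) -scalerDr.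
rewrite [- (_ + t *: q)]opprD !(scalerDr t _ (t *: _)).
rewrite [RHS](AC ((2*2)*2) ((1*5)*((2*6*3)*4))) /=.
by rewrite !scalerDr scalerN.
Qed.

Definition twisted_mul x s := mul x s - omega x *: s.
Local Notation T := twisted_mul.

Let TDZl x t y s : T (x + t *: y) s = T x s + t *: T y s.
Proof.
rewrite /twisted_mul linearDl linearZl_LR omegaDZ scalerDl opprD addrACA /=.
by rewrite scalerBr scalerA.
Qed.

Let TDZr x s t u : T x (s + t *: u) = T x s + t *: T x u.
Proof.
rewrite /twisted_mul linearDr linearZr_LR scalerDr opprD addrACA /=.
by rewrite scalerBr !scalerA mulrC.
Qed.

(** [T] is bilinear, so the expression is cubic in [t]; the hypothesis on [y] removes the
    coefficient of [t^3]. *)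
Lemma cubic_polarize x y : T y (mul y y) = 0 ->
  (forall t, t != 0 -> T (x + t *: y) (mul (x + t *: y) (x + t *: y)) = 0) ->
  T x (mul x x) = 0 /\ T x (mul x y + mul x y) + T y (mul x x) = 0.
Proof.
move=> fy fxy.
suff [] : [/\ T x (mul x x) = 0, T x (mul x y + mul x y) + T y (mul x x) = 0
  & T x (mul y y) + T y (mul x y + mul x y) = 0] by [].
apply: quadratic_coef_eq0 => t t0; rewrite -[RHS](fxy t t0).
rewrite sqrDZ TDZl !TDZr fy scaler0 addr0.
by rewrite -[RHS]addrA -[in RHS]scalerDr [in RHS]addrACA -[in RHS]scalerDr.
Qed.

Lemma cube_weight1 a : algebraic_of_degree_le mul 2 -> omega a = 1 ->
  T a (mul a a) = 0.
Proof.
move=> alg2 wa; have [_ _ _ B] := bern; rewrite /twisted_mul wa scale1r.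
set e := mul a a; have ee : mul e e = e by rewrite B wa expr1n scale1r.
have we : omega e = 1 by rewrite omegaM wa mulr1.
pose n := a - e; have wn : omega n = 0 by rewrite linearB /= wa we subrr.
have aE : a = e + n by rewrite addrC subrK.
set p := mul e n; have pp : mul e p + mul e p = p := idempotent_peirce ee we wn.
have aeE : mul a e = e + p by rewrite mulC aE linearDr ee.
rewrite aeE addrAC subrr add0r.
apply/eqP; apply: contraT => p0; exfalso.
have Sa : subalgebra_gen mul a a by exact: subalgebra_gen_id.
have Se : subalgebra_gen mul a e by exact: subalgebra_genM.
have Sae : subalgebra_gen mul a (mul a e) by exact: subalgebra_genM.
(* If [p] is nonzero, these three elements are independent, against degree at most 2. *)
pose v (i : 'I_3) := [:: a; e; mul a e]`_i.
apply: (@dim_le_dependent _ _ _ _ _ v (alg2 a)) => //.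
  by case=> [[|[|[|]]]].
move=> c; rewrite /linear_comb !big_ord_recl big_ord0 addr0 /v /=.
set c0 := c _; set c1 := c _; set c2 := c _ => dep.
(* All three vectors have weight 1, so [omega] of the relation is the sum of its coefficients. *)
have /eqP c012 : c0 + (c1 + c2) = 0.
  have := congr1 omega dep; rewrite !linearD !linearZ /= omegaM wa we !mulr1.
  by rewrite linear0.
have {dep}dep : c0 *: n + c2 *: p = 0.
  move: dep; rewrite aeE aE !scalerDr.
  rewrite (AC (2*(1*2)) ((1*(3*4))*(2*5))) /= -!scalerDl.
  by rewrite (eqP c012) scale0r add0r.
(* Multiply the relation by [e], double it and use [2 ep = p]. *)
have c2E : c2 = - (2 * c0).
  have := congr1 (mul e) dep; rewrite linearDr !linearZr_LR linear0 /=.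
  move=> epe; apply/eqP; rewrite -addr_eq0 addrC.
  have : (2 * c0 + c2) *: p == 0.
    rewrite scalerDl -{2}pp scalerDr mulr_natl mulr2n scalerDl.
    by rewrite addrACA epe addr0.
  by rewrite scaler_eq0 (negPf p0) orbF.
have c00 : c0 = 0.
  apply/eqP; apply: contraT => c0n0; case/negP: p0.
  have nE : n = p + p.
    apply: (scalerI c0n0); apply/eqP; rewrite -subr_eq0.
    by move/eqP: dep; rewrite c2E scaleNr mulr_natl mulr2n scalerDl -scalerDr.
  (* Since [n = 2p], expanding [e = (e + n)^2] gives [e = e + n + n^2]. *)
  have nn : n + mul n n = 0.
    have := sqrDZ e 1 n; rewrite !scale1r -aE ee -/p -nE => a2.
    by apply: (addrI e); rewrite addr0 -a2.
  have : mul (mul n n) (mul n n) = 0 by rewrite B wn expr0n scale0r.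
  have -> : mul n n = - n by apply/eqP; rewrite -addr_eq0 addrC nn.
  rewrite linearNl linearNr opprK => n2.
  by move: nn; rewrite n2 addr0 /p => ->; rewrite linear0.
have c20 : c2 = 0 by rewrite c2E c00 mulr0 oppr0.
have c10 : c1 = 0 by move/eqP: c012; rewrite c00 c20 add0r addr0.
case=> [[|[|[|//]]]] i.
- by rewrite -[RHS]c00; congr c; apply: val_inj.
- by rewrite -[RHS]c10; congr c; apply: val_inj.
by rewrite -[RHS]c20; congr c; apply: val_inj.
Qed.

(** Nonzero weight reduces to weight 1 by scaling. For weight 0, [x + t z] with [omega z] nonzero
    has nonzero weight for all nonzero [t], and polarization recovers the claim at [x]. *)
Lemma cube_weight x : algebraic_of_degree_le mul 2 -> T x (mul x x) = 0.
Proof.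
move=> alg2; have [_ [z wz] _ _] := bern.
have cube y : omega y != 0 -> T y (mul y y) = 0.
  move=> wy; have w1 : omega ((omega y)^-1 *: y) = 1 by rewrite linearZ /= mulVf.
  have := cube_weight1 alg2 w1; rewrite /twisted_mul w1.
  rewrite !(linearZl_LR, linearZr_LR) /= scale1r => h.
  have wi : (omega y)^-1 != 0 by rewrite invr_eq0.
  apply: (scalerI wi); apply: (scalerI wi); apply: (scalerI wi).
  by rewrite !scaler0 -[RHS]h /T !scalerBr (scalerA _ (omega y)) mulVf // scale1r.
have [wx|/cube //] := eqVneq (omega x) 0.
have [] // := @cubic_polarize x z (cube _ wz) => t t0.
by apply: cube; rewrite omegaDZ wx add0r mulf_neq0.
Qed.

Lemma bernstein_jordan : (forall x, T x (mul x x) = 0) -> is_jordan mul.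
Proof.
move=> cube; split=> // x y.
have pol z : T x (mul x z + mul x z) + T z (mul x x) = 0.
  by case: (@cubic_polarize x z).
(* Hence the terms [2 T x (x(xy))] of the two relations coincide and cancel. *)
have mulT s : mul x (T x s) = T x (mul x s).
  by rewrite /twisted_mul linearBr linearZr_LR.
have : T (mul x y) (mul x x) = mul x (T y (mul x x)).
  have := congr1 (mul x) (pol y).
  by rewrite linearDr mulT linearDr linear0 -(pol (mul x y)) => /addrI.
(* With this, the weight terms on both sides equal [omega x * omega y] times [x^2]. *)
have xxx : mul x (mul x x) = omega x *: mul x x.
  by apply/eqP; rewrite -subr_eq0; apply/eqP/cube.
rewrite /twisted_mul linearBr linearZr_LR /= xxx omegaM scalerA [omega y * _]mulrC.
by move/addIr; rewrite (mulC (mul x x) y) (mulC (mul x x) (mul x y)).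
Qed.

End BernsteinDegreeTwo.

Theorem corollary6p3 (K : fieldType)
    (Kinf : infinite_set [set: K])
    (Kchar2 : 2%N \notin [pchar K]) (Kchar3 : 3%N \notin [pchar K])
    (A : lmodType K) (mul : {bilinear A -> A -> A}) (omega : {scalar A}) :
  is_bernstein mul omega ->
  algebraic_of_degree_le mul 2 ->
  is_jordan mul.
Proof.
move=> bern alg2.
have K2 : (2 : K) != 0 by move: Kchar2; rewrite inE.
have K3 : (3 : K) != 0 by move: Kchar3; rewrite inE.
apply: (bernstein_jordan K2 K3 bern) => x.
exact: cube_weight.
Qed.
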